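(* Let $\mathcal{M}$ be the $1$-uniform matroid on $n$ elements. For every finite $m$ and every $1<\alpha\le\beta<n$, there does not exist a $\beta$-competitive $\alpha$-universal contention resolution scheme for $\mathcal{M}$ which is prior-independent with $m$ samples.
   Context: For a matroid $\mathcal{M}=(\mathcal{E},\mathcal{I})$: a contention resolution map (CRM) is a randomized function $\phi:2^{\mathcal{E}}\to\mathcal{I}$ with $\phi(R)\subseteq R$; it is $\alpha$-competitive for a distribution $\mathcal{D}$ on $2^{\mathcal{E}}$ if $\Pr_{R\sim\mathcal{D}}[i\in R]\le\alpha\Pr[i\in\phi(R)]$ for all $i\in\mathcal{E}$. $\mathcal{D}$ is $\alpha$-uncontentious if it admits an $\alpha$-competitive CRM. A contention resolution scheme (CRS) for a class of distributions is an algorithm which takes as input a (possibly partial or random) description of a distribution $\mathcal{D}$ in the class and a sample $R\sim\mathcal{D}$, and outputs an independent set $S\subseteq R$; equivalently it induces a CRM $\phi_{\mathcal{D}}$ for each $\mathcal{D}$. A CRS is $\beta$-competitive for a class if each induced $\phi_{\mathcal{D}}$ is $\beta$-competitive for $\mathcal{D}$. For $\beta\ge\alpha>1$, an $\alpha$-universal $\beta$-competitive CRS is one that is $\beta$-competitive for the class of all $\alpha$-uncontentious distributions. A CRS is prior-independent with $m$ samples if, instead of a full description of $\mathcal{D}$, it is given only $m$ independent samples from $\mathcal{D}$. *)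

(* Defs.v *)
From HB Require Import structures.
From mathcomp Require Import all_boot all_order all_algebra.
From mathcomp Require Import reals.

Set Implicit Arguments.
Unset Strict Implicit.
Unset Printing Implicit Defensive.

Import Order.TTheory GRing.Theory Num.Theory.
Local Open Scope ring_scope.

Record matroid (E : finType) := Matroid {
  indep : {set {set E}};
  indep0 : set0 \in indep;
  indepS : forall A B : {set E}, A \subset B -> B \in indep -> A \in indep;
  indep_aug : forall A B : {set E}, A \in indep -> B \in indep ->
    (#|A| < #|B|)%N -> exists2 x, x \in B :\: A & x |: A \in indep
}.

Section UniformMatroid.
Variables (E : finType) (k : nat).

Definition uniform_indep : {set {set E}} := [set A : {set E} | (#|A| <= k)%N].

Lemma uniform_indep0 : set0 \in uniform_indep.
Proof. by rewrite inE cards0. Qed.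

Lemma uniform_indepS (A B : {set E}) :
  A \subset B -> B \in uniform_indep -> A \in uniform_indep.
Proof. by move=> /subset_leq_card sAB; rewrite !inE; apply: leq_trans. Qed.

Lemma uniform_indep_aug (A B : {set E}) :
  A \in uniform_indep -> B \in uniform_indep -> (#|A| < #|B|)%N ->
  exists2 x, x \in B :\: A & x |: A \in uniform_indep.
Proof.
rewrite !inE => _ leBk ltAB.
have /set0Pn[x xBA] : B :\: A != set0.
  by rewrite setD_eq0; apply: contraL ltAB => /subset_leq_card; rewrite leqNgt.
exists x => //; rewrite inE cardsU1.
by move: xBA; rewrite inE => /andP[-> _]; apply: leq_trans leBk.
Qed.

Definition uniform_matroid : matroid E :=
  Matroid uniform_indep0 uniform_indepS uniform_indep_aug.

End UniformMatroid.

Record fdist (R : realType) (T : finType) := FDist {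
  pmf :> {ffun T -> R};
  pmf_ge0 : forall x, 0 <= pmf x;
  pmf_sum1 : \sum_x pmf x = 1
}.

Definition Pr (R : realType) (T : finType) (D : fdist R T) (P : pred T) : R :=
  \sum_(x | P x) D x.

Section Bind.
Variables (R : realType) (T U : finType) (D : fdist R T) (k : T -> fdist R U).

Definition bind_pmf : {ffun U -> R} := [ffun y => \sum_x D x * k x y].

Lemma bind_pmf_ge0 y : 0 <= bind_pmf y.
Proof. by rewrite ffunE sumr_ge0 // => x _; rewrite mulr_ge0 ?pmf_ge0. Qed.

Lemma bind_pmf_sum1 : \sum_y bind_pmf y = 1.
Proof.
under eq_bigr do rewrite ffunE.
rewrite exchange_big /= -(pmf_sum1 D); apply: eq_bigr => x _.
by rewrite -mulr_sumr pmf_sum1 mulr1.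
Qed.

(* The law of [y] obtained by drawing [x] from [D], then [y] from [k x]. *)
Definition fbind : fdist R U := FDist bind_pmf_ge0 bind_pmf_sum1.

End Bind.

Section Iid.
Variables (R : realType) (T : finType) (D : fdist R T) (m : nat).

Definition iid_pmf : {ffun {ffun 'I_m -> T} -> R} :=
  [ffun t : {ffun 'I_m -> T} => \prod_j D (t j)].

Lemma iid_pmf_ge0 t : 0 <= iid_pmf t.
Proof. by rewrite ffunE prodr_ge0 // => j _; apply: pmf_ge0. Qed.

Lemma iid_pmf_sum1 : \sum_t iid_pmf t = 1.
Proof.
under eq_bigr do rewrite ffunE.
by rewrite -(bigA_distr_bigA (fun _ => D)) big1 // => j _; apply: pmf_sum1.
Qed.

Definition iid : fdist R {ffun 'I_m -> T} := FDist iid_pmf_ge0 iid_pmf_sum1.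

End Iid.

(* A randomized function is encoded by the law of its output at each input;
   [crm_valid] says that the output is almost surely an independent subset of
   the input. *)
Record crm (R : realType) (E : finType) (M : matroid E) := CRM {
  crm_law :> {set E} -> fdist R {set E};
  crm_valid : forall A S : {set E},
    crm_law A S != 0 -> (S \in indep M) && (S \subset A)
}.

Section ContentionResolution.
Variables (R : realType) (E : finType) (M : matroid E).

Definition competitive (alpha : R) (D : fdist R {set E}) (phi : crm R M) :=
  forall i : E, Pr D (fun A => i \in A)
    <= alpha * Pr (fbind D phi) (fun S => i \in S).

Definition uncontentious (alpha : R) (D : fdist R {set E}) : Prop :=
  exists phi : crm R M, competitive alpha D phi.

(* A contention resolution scheme is represented by the maps it induces; for a
   scheme for a class of distributions, only the values on the class matter. *)
Definition crs := fdist R {set E} -> crm R M.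

Definition crs_competitive (C : fdist R {set E} -> Prop) (beta : R)
    (phi : crs) : Prop :=
  forall D, C D -> competitive beta D (phi D).

Definition universal_competitive (alpha beta : R) (phi : crs) : Prop :=
  crs_competitive (uncontentious alpha) beta phi.

(* [psi t] is the map used by the algorithm when the samples are [t]. The
   induced map averages over samples drawn independently of each other, of the
   input set [A], and of the algorithm's internal randomness. *)
Definition prior_independent (C : fdist R {set E} -> Prop) (m : nat)
    (phi : crs) : Prop :=
  exists psi : {ffun 'I_m -> {set E}} -> crm R M,
    forall D, C D -> forall A : {set E},
      phi D A =1 fbind (iid D m) (fun t => psi t A).

End ContentionResolution.

Arguments uncontentious {R E} M alpha D.
Arguments crs R {E} M.

(* Main.v *)
(** If the samples are all empty, the algorithm uses one fixed map, and since
    that map selects at most one element of [E], some [i] is selected from [E]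
    with probability at most [1/n].  Put mass [e] on [E], mass [e/(alpha-1)] on
    each singleton other than [{i}], and the rest on the empty set.  This is
    [alpha]-uncontentious: select [i] whenever the input is [E].  But [i] only
    ever occurs in the input [E], and as [e -> 0] the samples are all empty with
    probability tending to [1], so the competitive ratio at [i] tends to at
    least [n > beta]. *)
Require Import Defs.
From mathcomp Require Import all_boot all_order all_algebra.
From mathcomp Require Import reals ring lra.

Import Order.TTheory GRing.Theory Num.Theory.
Local Open Scope ring_scope.

Set Implicit Arguments.
Unset Strict Implicit.
Unset Printing Implicit Defensive.

Lemma bernoulli_inequality (R : realDomainType) (x : R) (m : nat) :
  0 <= x <= 1 -> 1 - m%:R * x <= (1 - x) ^+ m.
Proof.
case/andP=> x0 x1; elim: m => [|m IHm]; first by rewrite mul0r subr0 expr0.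
rewrite exprS; apply: le_trans (_ : (1 - x) * (1 - m%:R * x) <= _).
  have : 0 <= m%:R * x * x by rewrite !mulr_ge0.
  by rewrite -natr1; lra.
by rewrite ler_wpM2l // subr_ge0.
Qed.

(** * Probabilities under finite distributions *)

Section FiniteDistributions.
Variable R : realType.
Implicit Types T U : finType.

Lemma PrE T (D : fdist R T) (P : pred T) : Pr D P = \sum_x D x * (P x)%:R.
Proof.
rewrite /Pr big_mkcond; apply: eq_bigr => x _.
by case: (P x); rewrite ?mulr1 ?mulr0.
Qed.

Lemma Pr_ge0 T (D : fdist R T) (P : pred T) : 0 <= Pr D P.
Proof. by apply: sumr_ge0 => x _; apply: pmf_ge0. Qed.

Lemma Pr_le1 T (D : fdist R T) (P : pred T) : Pr D P <= 1.
Proof.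
rewrite PrE -[leRHS](pmf_sum1 D) ler_sum // => x _.
by case: (P x); rewrite ?mulr1 ?mulr0 ?pmf_ge0.
Qed.

Lemma eq_Pr T (D D' : fdist R T) (P : pred T) : D =1 D' -> Pr D P = Pr D' P.
Proof. by move=> eqD; apply: eq_bigr => x _; apply: eqD. Qed.

Lemma Pr_fbind T U (D : fdist R T) (k : T -> fdist R U) (P : pred U) :
  Pr (fbind D k) P = \sum_x D x * Pr (k x) P.
Proof.
rewrite /Pr; under eq_bigr do rewrite ffunE.
by rewrite exchange_big; apply: eq_bigr => x _; rewrite mulr_sumr.
Qed.

(** Split on whether the first draw is [x0]; every other draw is charged its full mass. *)
Lemma Pr_fbind_le T U (D : fdist R T) (k : T -> fdist R U) (P : pred U) x0 :
  Pr (fbind D k) P <= Pr (k x0) P + (1 - D x0).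
Proof.
rewrite Pr_fbind (bigD1 x0) //= -(pmf_sum1 D) [in leRHS](bigD1 x0) //=.
rewrite [X in _ <= _ + X]addrC addKr lerD //.
  rewrite ler_piMl ?Pr_ge0 // -(pmf_sum1 D) (bigD1 x0) //= lerDl.
  by rewrite sumr_ge0 // => x _; apply: pmf_ge0.
by rewrite ler_sum // => x _; rewrite ler_piMr ?pmf_ge0 ?Pr_le1.
Qed.

Section Dirac.
Variables (T : finType) (a : T).

Definition dirac_pmf : {ffun T -> R} := [ffun x => (x == a)%:R].

Lemma dirac_pmf_ge0 x : 0 <= dirac_pmf x.
Proof. by rewrite ffunE ler0n. Qed.

Lemma dirac_expectation (f : T -> R) : \sum_x (x == a)%:R * f x = f a.
Proof.
rewrite (bigD1 a) //= eqxx mul1r big1 ?addr0 // => x /negbTE->.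
by rewrite mul0r.
Qed.

Lemma dirac_pmf_sum1 : \sum_x dirac_pmf x = 1.
Proof.
rewrite -[RHS](dirac_expectation (fun=> 1)).
by apply: eq_bigr => x _; rewrite ffunE mulr1.
Qed.

Definition dirac : fdist R T := FDist dirac_pmf_ge0 dirac_pmf_sum1.

Lemma Pr_dirac (P : pred T) : Pr dirac P = (P a)%:R.
Proof.
rewrite PrE -[RHS](dirac_expectation (fun x => (P x)%:R)).
by apply: eq_bigr => x _; rewrite ffunE.
Qed.

End Dirac.
End FiniteDistributions.

(** * Selection probabilities of contention resolution maps *)

Lemma crm_select_notin (R : realType) (E : finType) (M : matroid E)
    (phi : crm R M) (A : {set E}) (i : E) :
  i \notin A -> Pr (phi A) (fun S => i \in S) = 0.
Proof.
move=> iA; apply: big1 => S iS; apply/eqP; apply: contraNT iA.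
by case/crm_valid/andP=> _ /subsetP; apply.
Qed.

(** The sum is the expected size of the selected set, which is almost surely at most 1. *)
Lemma sum_select_uniform1_le1 (R : realType) (E : finType)
    (phi : crm R (uniform_matroid E 1)) (A : {set E}) :
  \sum_i Pr (phi A) (fun S => i \in S) <= 1.
Proof.
under eq_bigr do rewrite PrE.
rewrite exchange_big /= -[leRHS](pmf_sum1 (phi A)) ler_sum // => S _.
rewrite -mulr_sumr; have [->|] := eqVneq (phi A S) 0; first by rewrite mul0r.
case/crm_valid/andP; rewrite inE => S1 _.
rewrite ler_piMr ?pmf_ge0 // -natr_sum lern1.
by rewrite -big_mkcond /= sum1_card.
Qed.

Lemma ex_select_uniform1_le (R : realType) (E : finType)
    (phi : crm R (uniform_matroid E 1)) (A : {set E}) :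
  (0 < #|E|)%N -> exists i, #|E|%:R * Pr (phi A) (fun S => i \in S) <= 1.
Proof.
move=> E0; apply/existsP; apply: contraT; rewrite negb_exists => /forallP big.
have : \sum_(i : E) #|E|%:R * Pr (phi A) (fun S => i \in S) <= #|E|%:R.
  by rewrite -mulr_sumr ler_piMr // sum_select_uniform1_le1.
have [i0 _] := card_gt0P E0.
rewrite leNgt -[ltLHS]sumr_const => /negP[]; apply: ltr_sum.
  by apply/hasP; exists i0 => //; rewrite mem_index_enum.
by move=> i _; rewrite ltNge big.
Qed.

(** * The hard distribution and its uncontentiousness *)

Section HardDistribution.
Variables (R : realType) (E : finType) (i : E) (e d : R).
Hypotheses (e_ge0 : 0 <= e) (d_ge0 : 0 <= d).
Let p := e + (#|E|.-1)%:R * d.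
Hypothesis p_le1 : p <= 1.

(** Written as a combination of point masses, so that expectations are computed term by term. *)
Definition hard_pmf : {ffun {set E} -> R} := [ffun A : {set E} =>
  e * (A == setT)%:R + d * \sum_(j | j != i) (A == [set j])%:R
  + (1 - p) * (A == set0)%:R].

Lemma hard_expectation (f : {set E} -> R) :
  \sum_A hard_pmf A * f A =
  e * f setT + d * \sum_(j | j != i) f [set j] + (1 - p) * f set0.
Proof.
under eq_bigr do rewrite ffunE !mulrDl -!mulrA mulr_suml.
rewrite !big_split /= -!mulr_sumr !dirac_expectation exchange_big /=.
by under [X in d * X]eq_bigr do rewrite dirac_expectation; rewrite -mulrDl.
Qed.

Lemma hard_pmf_ge0 A : 0 <= hard_pmf A.
Proof.
by rewrite ffunE !addr_ge0 ?mulr_ge0 ?subr_ge0 // sumr_ge0.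
Qed.

Lemma hard_pmf_sum1 : \sum_A hard_pmf A = 1.
Proof.
transitivity (\sum_A hard_pmf A * 1); first by under [RHS]eq_bigr do rewrite mulr1.
rewrite hard_expectation sumr_const cardC1 /p.
by rewrite -[1 *+ _]/(_%:R); ring.
Qed.

Definition hard_dist : fdist R {set E} := FDist hard_pmf_ge0 hard_pmf_sum1.

Lemma hard_dist_set0 : 1 - p <= hard_dist set0.
Proof.
by rewrite ffunE eqxx mulr1 lerDr addr_ge0 ?mulr_ge0 // sumr_ge0.
Qed.

Lemma Pr_hard_mem k : Pr hard_dist (fun A => k \in A) = e + d * (k != i)%:R.
Proof.
rewrite PrE hard_expectation inE in_set0 mulr1 mulr0 addr0; congr (_ + d * _).
under eq_bigr do rewrite inE.
rewrite big_mkcond -[RHS](dirac_expectation k (fun j => (j != i)%:R)).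
apply: eq_bigr => j _; rewrite [k == j]eq_sym.
by case: (j != i); rewrite ?mulr1 ?mulr0.
Qed.

Lemma Pr_hard_select (M : matroid E) (phi : crm R M) :
  Pr (fbind hard_dist phi) (fun S => i \in S) =
  e * Pr (phi setT) (fun S => i \in S).
Proof.
rewrite Pr_fbind hard_expectation [in X in _ + X]crm_select_notin ?inE //.
rewrite big1 ?mulr0 ?addr0 // => j ji.
by rewrite crm_select_notin // inE eq_sym.
Qed.

(** The last case lies off the support of [hard_dist]; [set0] is a default that keeps the map
    valid. *)
Definition favour (A : {set E}) : {set E} :=
  if A == setT then [set i] else if (#|A| <= 1)%N then A else set0.

Lemma favour_valid (A S : {set E}) :
  dirac R (favour A) S != 0 -> (S \in indep (uniform_matroid E 1)) && (S \subset A).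
Proof.
rewrite ffunE; have [-> _|_] := eqVneq S (favour A); last by rewrite eqxx.
rewrite inE /favour; have [->|_] := eqVneq A setT.
  by rewrite cards1 subsetT.
by case: ifP => [->|_]; rewrite ?subxx // cards0 sub0set.
Qed.

(** Under [favour], [i] is selected whenever present. Any other element is present with probability
    [e + d] and selected with probability [d], and the bound on [e] says [e + d <= alpha * d]. *)
Lemma hard_uncontentious (alpha : R) :
  (1 < #|E|)%N -> 1 <= alpha -> e <= (alpha - 1) * d ->
  uncontentious (uniform_matroid E 1) alpha hard_dist.
Proof.
move=> E1 a1 ed; exists (CRM favour_valid) => k.
have select A : Pr (CRM favour_valid A) (fun S => k \in S) = (k \in favour A)%:R.
  exact: Pr_dirac.
have -> : Pr (fbind hard_dist (CRM favour_valid)) (fun S => k \in S) =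
    e * (k == i)%:R + d * (k != i)%:R.
  rewrite Pr_fbind hard_expectation !select.
  have -> : favour set0 = set0.
    by rewrite /favour cards0 eq_sym -cards_eq0 cardsT; case: #|E| E1.
  rewrite inE mulr0 addr0 /favour eqxx inE; congr (_ + d * _).
  rewrite big_mkcond -[RHS](dirac_expectation k (fun j => (j != i)%:R)).
  apply: eq_bigr => j _; rewrite select /favour.
  have -> : ([set j] == setT) = false.
    apply/negbTE; apply: contraTneq E1.
    by move=> /(congr1 (fun A : {set E} => #|A|)); rewrite cards1 cardsT => <-.
  rewrite cards1 inE [k == j]eq_sym.
  by case: (j != i); rewrite ?mulr1 ?mulr0.
rewrite Pr_hard_mem; case: (k == i) => /=; rewrite ?mulr1 ?mulr0 ?addr0 ?add0r.
  by rewrite ler_peMl.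
by move: ed; lra.
Qed.

End HardDistribution.

(** * Choice of the parameters and contradiction *)

Theorem theorem4 (R : realType) (n : nat) (E : finType) (hE : #|E| = n)
    (m : nat) (alpha beta : R) (h1alpha : 1 < alpha) (halphabeta : alpha <= beta)
    (hbetan : beta < n%:R) :
  ~ exists phi : crs R (uniform_matroid E 1),
      universal_competitive alpha beta phi /\
      prior_independent (uncontentious (uniform_matroid E 1) alpha) m phi.
Proof.
case=> phi [compet [psi psiP]]; subst n.
have E1 : (1 < #|E|)%N by rewrite -(ltr_nat R); lra.
have n0 : 0 < #|E|%:R :> R by rewrite ltr0n ltnW.
(* The map [psi t0] does not depend on the distribution, so [i] can be fixed before [D] is built
   around it. *)
pose t0 : {ffun 'I_m -> {set E}} := [ffun=> set0].
have [i qi] := ex_select_uniform1_le (psi t0) setT (ltnW E1).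
set q := Pr _ _ in qi.
have m0 : 0 <= m%:R :> R by [].
have mb1 : 0 < 1 + beta * m%:R by nra.
have c1 : 0 < alpha - 1 by rewrite subr_gt0.
have beta0 : 0 < beta by lra.
(* [x] will be the mass of the nonempty sets. It is chosen so that
   [beta * (1 / #|E| + m * x) = 1 - x], which is below 1. *)
pose x : R := (1 - beta / #|E|%:R) / (1 + beta * m%:R).
have gap : 0 < 1 - beta / #|E|%:R by rewrite subr_gt0 ltr_pdivrMr ?mul1r.
have x0 : 0 < x by rewrite divr_gt0.
have xE : x + beta * (m%:R * x) = 1 - beta / #|E|%:R.
  by rewrite mulrA -[X in X + _]mul1r -mulrDl mulrC divfK ?gt_eqF.
have x1 : x <= 1.
  have mx0 : 0 <= m%:R * x by apply: mulr_ge0 => //; apply: ltW.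
  have bmx0 : 0 <= beta * (m%:R * x) by apply: mulr_ge0 => //; apply: ltW.
  have bn0 : 0 <= beta / #|E|%:R by apply: divr_ge0; apply: ltW.
  lra.
(* [c * e] is the mass of the nonempty sets. *)
pose c : R := 1 + #|E|.-1%:R / (alpha - 1).
have c0 : 0 < c by rewrite ltr_pwDl ?divr_ge0 //; exact: ltW.
pose e := x / c; have e0 : 0 < e by rewrite divr_gt0.
(* The least [d] for which [hard_uncontentious] applies. *)
pose d := e / (alpha - 1); have d0 : 0 < d by rewrite divr_gt0.
have pE : e + #|E|.-1%:R * d = x.
  by rewrite -[RHS](divfK (lt0r_neq0 c0)) -/e /c /d; ring.
have p1 : e + #|E|.-1%:R * d <= 1 by rewrite pE.
pose D := hard_dist i (ltW e0) (ltW d0) p1.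
have Dunc : uncontentious (uniform_matroid E 1) alpha D.
  apply: hard_uncontentious => //; first exact: ltW.
  by rewrite /d mulrC divfK ?gt_eqF.
have all_empty : 1 - m%:R * x <= iid D m t0.
  apply: le_trans (bernoulli_inequality _ _) _; first by rewrite x1 ltW.
  rewrite [leRHS]ffunE; under eq_bigr => j _ do rewrite [t0 j]ffunE.
  rewrite prodr_const card_ord lerXn2r ?nnegrE ?subr_ge0 ?pmf_ge0 //.
  by rewrite -pE hard_dist_set0.
have select_i : Pr (phi D setT) (fun S => i \in S) <= q + m%:R * x.
  rewrite (eq_Pr _ (psiP D Dunc setT)).
  apply: le_trans (Pr_fbind_le _ _ _ t0) _.
  by rewrite -/q; lra.
have q_le : q <= #|E|%:R^-1 by rewrite -[leRHS]mul1r ler_pdivlMr // mulrC.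
have := compet D Dunc i.
(* Both sides carry the factor [e], since [i] occurs only in the full set; cancelling it leaves
   [1 <= beta * Pr], with [Pr] the probability that [i] is selected from [setT]. *)
rewrite Pr_hard_select Pr_hard_mem eqxx mulr0 addr0 mulrCA -[leLHS]mulr1.
rewrite ler_pM2l //; apply/negP; rewrite -ltNge.
apply: le_lt_trans (_ : beta * (#|E|%:R^-1 + m%:R * x) < 1).
  by rewrite ler_pM2l //; lra.
by move: xE; rewrite mulrDr; lra.
Qed.
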